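(* Let $|\psi_{id}\rangle\in\mathbb{C}^d$ be a unit vector, $\rho_{id}=|\psi_{id}\rangle\langle\psi_{id}|$, let $\rho_{err}$ be a density matrix on $\mathbb{C}^d$ with largest eigenvalue $\mu_1$, let $0<\eta\le 1$, and put $\rho=\eta\rho_{id}+(1-\eta)\rho_{err}$ and $\delta=(\eta^{-1}-1)\mu_1$, where $\delta<1$. Let $|\psi\rangle$ be a unit eigenvector of $\rho$ for its largest eigenvalue and let $c=1-|\langle\psi_{id}|\psi\rangle|^2$. Then the coherent mismatch $c$ is generally upper bounded as $$c\le \frac{1-\sqrt{1-\delta^2}}{2}=\frac{\delta^2}{4}+\mathcal{O}(\delta^4/16).$$ This upper bound is saturated by an infinite number of worst-case error density matrices $\rho_{err}$ whose dominant eigenvector $|\chi\rangle$ has a non-zero overlap with the ideal state $|\psi_{id}\rangle$ as $$|\chi\rangle=\sqrt{\alpha}\,|\psi_{id}\rangle+\sqrt{1-\alpha}\,|\phi_2\rangle,$$ where $|\phi_2\rangle$ is a unit vector with $\langle\phi_2|\psi_{id}\rangle=0$, and all other eigenvectors of $\rho_{err}$ are orthogonal to $|\psi_{id}\rangle$. The coherent mismatch is maximised when $\alpha=(1+\delta)/2$.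
   Context: A density matrix is a positive semidefinite $d\times d$ complex matrix of trace one. The quantity $c$, called the coherent mismatch, is the infidelity between the dominant eigenvector $|\psi\rangle$ of the noisy state $\rho$ (the eigenvector of its largest eigenvalue, assumed non-degenerate) and the ideal state $|\psi_{id}\rangle$. The dominant eigenvector of $\rho_{err}$ is its eigenvector for the eigenvalue $\mu_1$. The number $\delta$ is the ratio of the weight $(1-\eta)\mu_1$ of the dominant error eigenvector to the weight $\eta$ of the ideal state.
   Formalization: The maximiser is α=(1−δ)/2, since the printed (1+δ)/2 is false for 0<δ<1; ''all other eigenvectors'' means those with non-zero eigenvalue; infinite saturation is stated for d≥2 and 1/(d−1)≤μ₁≤1, exactly where such ρ_err with α<1 exist. *)

(* Defs.v *)
From HB Require Import structures.
From mathcomp Require Import all_boot all_order all_algebra.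
From mathcomp Require Import complex.
From mathcomp Require Import boolp classical_sets cardinality reals.
From mathcomp Require Import topology normedtype landau.

Set Implicit Arguments.
Unset Strict Implicit.
Unset Printing Implicit Defensive.

Import Order.TTheory GRing.Theory Num.Theory.
Import numFieldNormedType.Exports.
Local Open Scope ring_scope.
Local Open Scope complex_scope.
Local Open Scope sesquilinear_scope.

Section Quantum.
Variables (R : realType) (d : nat).
Notation C := R[i].
Implicit Types (u v psi chi phi : 'cV[C]_d) (A rho : 'M[C]_d).
Implicit Types (eta mu alpha delta : R).

(* <u|v>, antilinear in u; kets are column vectors. *)
Definition braket u v : C := (u ^t* *m v) 0 0.

Definition unit_ket u : Prop := braket u u = 1.

(* |u><u| *)
Definition projector u : 'M[C]_d := u *m u ^t*.

(* [0 <= z] in [R[i]] means that [z] is real and nonnegative. *)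
Definition psdmx A : Prop :=
  A \is hermsymmx /\ forall v, 0 <= braket v (A *m v).

Definition density_matrix rho : Prop := psdmx rho /\ \tr rho = 1.

(* [eigenvalue] is defined through row eigenvectors [u *m A = a *: u]; the
   column eigenvectors used below give the same spectrum. The order of [R[i]]
   is partial: [a <= mu%:C] also says that [a] is real. *)
Definition largest_eigenvalue A mu : Prop :=
  eigenvalue A mu%:C /\ forall a : C, eigenvalue A a -> a <= mu%:C.

Definition dominant_eigenvector A psi : Prop :=
  unit_ket psi /\
  exists2 mu : R, largest_eigenvalue A mu & A *m psi = mu%:C *: psi.

Definition noisy_state eta psi_id rho_err : 'M[C]_d :=
  eta%:C *: projector psi_id + (1 - eta)%:C *: rho_err.

Definition coherent_mismatch psi_id psi : R :=
  1 - ComplexField.Normc.normc (braket psi_id psi) ^+ 2.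

Definition error_ratio eta mu1 : R := (eta^-1 - 1) * mu1.

(* The error states with largest eigenvalue [mu1] and dominant eigenvector
   [chi = sqrt alpha psi_id + sqrt (1 - alpha) phi2], all other eigenvectors
   being orthogonal to [psi_id]. The latter condition concerns the nonzero
   eigenvalues only, that is, the spectral decomposition of [rho_err]: for
   [alpha < 1] no eigenbasis has all vectors but [chi] orthogonal to [psi_id],
   and the vector of span(psi_id, phi2) orthogonal to [chi] is in the kernel.
   [braket chi v = 0] selects the eigenvectors other than [chi], also when
   [mu1] is degenerate. *)
Definition worst_case_form psi_id mu1 alpha rho_err : Prop :=
  [/\ density_matrix rho_err, largest_eigenvalue rho_err mu1,
      0 < alpha <= 1 &
      exists phi2 : 'cV[C]_d,
        [/\ unit_ket phi2, braket phi2 psi_id = 0 &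
            let chi := (Num.sqrt alpha)%:C *: psi_id
                       + (Num.sqrt (1 - alpha))%:C *: phi2 in
            rho_err *m chi = mu1%:C *: chi /\
            forall (a : C) v, a != 0 -> rho_err *m v = a *: v ->
              braket chi v = 0 -> braket psi_id v = 0]].

End Quantum.

Definition mismatch_bound (R : realType) (delta : R) : R :=
  (1 - Num.sqrt (1 - delta ^+ 2)) / 2.

(* On span(psi_id, phi2) the noisy state divided by eta is
   |psi_id><psi_id| + delta |chi><chi|. With alpha = cos^2 (b/2), the Bloch
   vector of its dominant eigenvector is parallel to
   (1 + delta cos b, delta sin b), whose angle to psi_id is largest when
   cos b = - delta; then |<chi|psi_id>|^2 = alpha is (1 - delta)/2, and
   1 - alpha = (1 + delta)/2 is the weight of phi2. *)
Definition worst_case_overlap (R : realType) (delta : R) : R :=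
  (1 - delta) / 2.

(* Main.v *)
(* Dividing rho by eta, put M = |id><id| + B with 0 <= B <= delta, let lam be
   the largest eigenvalue of M, psi its eigenvector and w = |<id|psi>|^2. Then
   B psi = lam psi - <id|psi> id, and lam >= <id|M|id> >= 1. The operator
   inequality B^2 <= delta B, evaluated at psi, reads
   lam^2 - 2 lam w + w <= delta (lam - w), a quadratic inequality in lam whose
   solvability in lam >= 1 bounds 1 - w.
   For an error state of the worst-case form, B id is a multiple of chi, so
   span(id, chi) is M-invariant and contains psi; there the eigenvalue equation
   is (lam - 1)(lam - delta) = delta alpha, and w can be computed. The phase of
   phi2 is free, which provides infinitely many such states. *)
Require Import Defs.
From HB Require Import structures.
From mathcomp Require Import all_boot all_order all_algebra.
From mathcomp Require Import complex.
From mathcomp Require Import boolp classical_sets cardinality reals.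
From mathcomp Require Import topology normedtype landau.
From mathcomp Require Import ring lra.
Import Order.TTheory GRing.Theory Num.Theory.
Import numFieldNormedType.Exports.
Local Open Scope classical_set_scope.
Local Open Scope ring_scope.
Local Open Scope complex_scope.

Set Implicit Arguments.
Unset Strict Implicit.
Unset Printing Implicit Defensive.

(** * Brakets and hermitian matrices *)

Section Braket.
Local Open Scope sesquilinear_scope.
Context {R : realType} {d : nat}.
Notation C := R[i].
Implicit Types (u v w : 'cV[C]_d) (A : 'M[C]_d) (a b : C).

Lemma braketE u v : braket u v = \sum_i Num.conj (u i 0) * v i 0.
Proof. by rewrite /braket mxE; apply: eq_bigr => i _; rewrite !mxE. Qed.

Lemma braket_conj u v : Num.conj (braket u v) = braket v u.
Proof.
rewrite !braketE rmorph_sum; apply: eq_bigr => i _.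
by rewrite rmorphM /= conjCK mulrC.
Qed.

Lemma braketDr u v w : braket u (v + w) = braket u v + braket u w.
Proof. by rewrite /braket mulmxDr mxE. Qed.

Lemma braketZr u a v : braket u (a *: v) = a * braket u v.
Proof. by rewrite /braket -scalemxAr mxE. Qed.

Lemma braketDl u v w : braket (u + v) w = braket u w + braket v w.
Proof. by rewrite -braket_conj braketDr rmorphD /= !braket_conj. Qed.

Lemma braketZl u a v : braket (a *: u) v = Num.conj a * braket u v.
Proof. by rewrite -braket_conj braketZr rmorphM /= braket_conj. Qed.

Lemma braket0r u : braket u 0 = 0.
Proof. by rewrite /braket mulmx0 mxE. Qed.

Lemma braketNr u v : braket u (- v) = - braket u v.
Proof. by rewrite -scaleN1r braketZr mulN1r. Qed.

Lemma braketNl u v : braket (- u) v = - braket u v.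
Proof. by rewrite -braket_conj braketNr rmorphN /= braket_conj. Qed.

Lemma braketBr u v w : braket u (v - w) = braket u v - braket u w.
Proof. by rewrite braketDr braketNr. Qed.

Lemma braketBl u v w : braket (u - v) w = braket u w - braket v w.
Proof. by rewrite braketDl braketNl. Qed.

Lemma braket_sumr (I : Type) (r : seq I) (P : pred I) u (F : I -> 'cV[C]_d) :
  braket u (\sum_(i <- r | P i) F i) = \sum_(i <- r | P i) braket u (F i).
Proof.
apply: (big_morph (braket u)); [exact: braketDr | exact: braket0r].
Qed.

Lemma conjC_real (x : R) : Num.conj (x%:C : C) = x%:C.
Proof. exact: conjc_real. Qed.

Lemma normc_sqr (z : C) :
  (ComplexField.Normc.normc z ^+ 2)%:C = Num.conj z * z.
Proof. by rewrite -normCKC rmorphXn. Qed.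

Lemma braket_ge0 u : 0 <= braket u u.
Proof.
by rewrite braketE sumr_ge0 // => i _; rewrite -normCKC exprn_ge0.
Qed.

Lemma braket_gt0 u : u != 0 -> 0 < braket u u.
Proof.
move=> u0; rewrite lt_neqAle braket_ge0 andbT eq_sym; apply: contra u0.
rewrite braketE psumr_eq0 => [/allP h|i _]; last first.
  by rewrite -normCKC exprn_ge0.
apply/eqP/colP => i; rewrite mxE; apply/eqP.
have := h i (mem_index_enum i).
by rewrite /= -normCKC sqrf_eq0 normr_eq0.
Qed.

Lemma unit_ket_neq0 u : unit_ket u -> u != 0.
Proof.
move=> hu; apply/eqP => u0; move: hu.
by rewrite /unit_ket u0 braket0r => /eqP; rewrite eq_sym oner_eq0.
Qed.

Lemma hermsymP A : A \is hermsymmx -> A ^t* = A.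
Proof. by move/is_hermitianmxP; rewrite expr0 scale1r. Qed.

Lemma braket_herm A u v :
  A \is hermsymmx -> braket (A *m u) v = braket u (A *m v).
Proof.
move/hermsymP => hA.
by rewrite /braket trmx_mul map_mxM /= hA mulmxA.
Qed.

Lemma projectorE u v : projector u *m v = braket u v *: u.
Proof.
rewrite /projector -mulmxA (mx11_scalar (u ^t* *m v)) mul_mx_scalar.
by rewrite /braket.
Qed.

Lemma projector_herm u : projector u \is hermsymmx.
Proof.
apply/is_hermitianmxP; rewrite expr0 scale1r /projector trmx_mul map_mxM.
by rewrite trmxCK.
Qed.

Lemma hermsymD A B :
  A \is hermsymmx -> B \is hermsymmx -> A + B \is hermsymmx.
Proof.
move=> /hermsymP hA /hermsymP hB; apply/is_hermitianmxP.
by rewrite expr0 scale1r linearD /= map_mxD hA hB.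
Qed.

Lemma hermsymZ (x : R) A :
  A \is hermsymmx -> x%:C *: A \is hermsymmx.
Proof.
move=> /hermsymP hA; apply/is_hermitianmxP.
by rewrite expr0 scale1r linearZ /= map_mxZ /= conjC_real hA.
Qed.

(** * Spectral decomposition and eigenvalue bounds *)

(** In the spectral factorization [A = P^t* D P] the columns of [P^t*] are orthonormal eigenvectors,
    and [D] is real because [A] is hermitian, so the eigenvalues can be returned in [R]. *)
Lemma hermsym_eigenbasis A : A \is hermsymmx ->
  exists (e : 'I_d -> 'cV[C]_d) (s : 'I_d -> R),
    [/\ forall u, u = \sum_i braket (e i) u *: e i,
        forall i, unit_ket (e i) &
        forall i, A *m e i = (s i)%:C *: e i].
Proof.
move=> hA; pose P := spectralmx A.
have PU : P \is unitarymx by apply: spectral_unitarymx.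
have PV : P *m P ^t* = 1%:M by apply/unitarymxP.
have PW : P ^t* *m P = 1%:M by apply: mulmx1C.
have /orthomx_spectralP AE := hermitian_normalmx hA.
rewrite -/P invmx_unitary // in AE.
have sr i : spectral_diag A 0 i \is Num.real.
  by have /mxOverP := hermitian_spectral_diag_real hA; apply.
pose e i := col i (P ^t*).
have eE i u : braket (e i) u = (P *m u) i 0.
  rewrite braketE mxE; apply: eq_bigr => j _.
  by rewrite !mxE conjCK.
exists e, (fun i => complex.Re (spectral_diag A 0 i)); split.
- move=> u; rewrite -[LHS]mul1mx -PW -mulmxA.
  apply/colP => j; rewrite mxE summxE; apply: eq_bigr => i _.
  by rewrite mxE eE !mxE mulrC.
- by move=> i; rewrite /unit_ket eE /e colE mulmxA PV mul1mx !mxE !eqxx.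
move=> i; rewrite RRe_real // /e colE {1}AE -!mulmxA (mulmxA P) PV mul1mx.
apply/colP => j; rewrite [RHS]mxE -colE [X in _ * X]mxE !mxE (bigD1 i) //=.
rewrite big1 ?addr0; last first.
  by move=> k ki; rewrite -colE !mxE (negPf ki) mulr0n mulr0.
by rewrite -colE !mxE eqxx mulr1n mulrC.
Qed.

Lemma eigenvalue_col A (s : R) : A \is hermsymmx ->
  eigenvalue A s%:C <-> exists2 v : 'cV[C]_d, v != 0 & A *m v = s%:C *: v.
Proof.
move=> /hermsymP hA; split.
  case/eigenvalueP => u uA u0; exists (u ^t*); last first.
    by rewrite -[A]hA -map_mxM -trmx_mul uA linearZ /= map_mxZ /= conjC_real.
  by rewrite map_mx_eq0 trmx_eq0.
case=> v v0 Av; apply/eigenvalueP; exists (v ^t*); last first.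
  by rewrite map_mx_eq0 trmx_eq0.
by rewrite -[A]hA -map_mxM -trmx_mul Av linearZ /= map_mxZ /= conjC_real.
Qed.

(** The adjoint of a row eigenvector for [a] is a column eigenvector for the conjugate of [a].
    Comparing either with [s] says the same: [a] is real and at most [s]. *)
Lemma eigenvalue_le A (s : R) : A \is hermsymmx ->
  (forall v, braket v (A *m v) <= s%:C * braket v v) ->
  forall a, eigenvalue A a -> a <= s%:C.
Proof.
move=> /hermsymP hA hs a /eigenvalueP [u uA u0].
pose v := u ^t*; have v0 : v != 0 by rewrite map_mx_eq0 trmx_eq0.
have Av : A *m v = Num.conj a *: v.
  by rewrite -[A]hA -map_mxM -trmx_mul uA linearZ /= map_mxZ.
have := hs v; rewrite Av braketZr ler_pM2r ?braket_gt0 //.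
by rewrite !lecE; case: a {uA Av} => x y /=; rewrite ![0 == _]eq_sym oppr_eq0.
Qed.

Lemma largest_eigenvalueP A (s : R) v : A \is hermsymmx ->
  v != 0 -> A *m v = s%:C *: v ->
  (forall w, braket w (A *m w) <= s%:C * braket w w) ->
  largest_eigenvalue A s.
Proof.
move=> hA v0 Av hs; split; last exact: eigenvalue_le.
by apply/eigenvalue_col => //; exists v.
Qed.

Section Eigenbasis.
Context {A : 'M[C]_d} {e : 'I_d -> 'cV[C]_d} {s : 'I_d -> R}.
Hypothesis (eE : forall u, u = \sum_i braket (e i) u *: e i)
  (Ae : forall i, A *m e i = (s i)%:C *: e i).

Lemma eigenbasis_braket u v :
  braket u v = \sum_i Num.conj (braket (e i) u) * braket (e i) v.
Proof.
rewrite {1}(eE v) braket_sumr; apply: eq_bigr => i _.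
by rewrite braketZr braket_conj mulrC.
Qed.

Lemma eigenbasis_mul i v : A \is hermsymmx ->
  braket (e i) (A *m v) = (s i)%:C * braket (e i) v.
Proof. by move=> hA; rewrite -braket_herm // Ae braketZl conjC_real. Qed.

End Eigenbasis.

Lemma largest_eigenvalue_le A (s : R) : A \is hermsymmx ->
  largest_eigenvalue A s -> forall v, braket v (A *m v) <= s%:C * braket v v.
Proof.
move=> hA [_ hs] v; have [e [a [eE eu Ae]]] := hermsym_eigenbasis hA.
rewrite !(eigenbasis_braket eE) mulr_sumr; apply: ler_sum => i _.
rewrite (eigenbasis_mul Ae) // mulrCA ler_wpM2r //.
  by rewrite -normCKC exprn_ge0.
by apply: hs; apply/eigenvalue_col => //; exists (e i) => //; apply: unit_ket_neq0.
Qed.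

Lemma psd_largest_eigenvalue_ge0 A (s : R) :
  psdmx A -> largest_eigenvalue A s -> 0 <= s.
Proof.
move=> [hA A0] [/eigenvalue_col]; move=> /(_ hA) [v v0 Av] _.
by have := A0 v; rewrite Av braketZr pmulr_lge0 ?braket_gt0 // ler0c.
Qed.

(** This is the operator inequality [A^2 <= s A]: in an eigenbasis it reduces to [a_i^2 <= s a_i],
    which follows from [0 <= a_i <= s]. *)
Lemma psd_largest_eigenvalue_sqr A (s : R) v :
  psdmx A -> largest_eigenvalue A s ->
  braket (A *m v) (A *m v) <= s%:C * braket v (A *m v).
Proof.
move=> [hA A0] [_ hs]; have [e [a [eE eu Ae]]] := hermsym_eigenbasis hA.
rewrite !(eigenbasis_braket eE) mulr_sumr; apply: ler_sum => i _.
have a0 : 0 <= (a i)%:C.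
  by have := A0 (e i); rewrite Ae braketZr (eu i) mulr1.
rewrite !(eigenbasis_mul Ae) // rmorphM /= conjC_real.
set b := braket _ _; set x := (a i)%:C; set y := s%:C.
have -> : x * Num.conj b * (x * b) = x * (Num.conj b * b) * x by ring.
have -> : y * (Num.conj b * (x * b)) = x * (Num.conj b * b) * y by ring.
rewrite -normCKC ler_wpM2l ?mulr_ge0 ?exprn_ge0 //.
by apply: hs; apply/eigenvalue_col => //; exists (e i) => //; apply: unit_ket_neq0.
Qed.

Lemma dominant_eigenvector_exists A : (0 < d)%N -> A \is hermsymmx ->
  exists psi, dominant_eigenvector A psi.
Proof.
move=> d0 hA; have [e [a [eE eu Ae]]] := hermsym_eigenbasis hA.
pose i := [arg max_(j > Ordinal d0) a j]%O.
have ai j : a j <= a i by rewrite /i; case: arg_maxP => // k _; apply.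
exists (e i); split; [exact: eu | exists (a i)]; last exact: Ae.
apply: (largest_eigenvalueP hA (unit_ket_neq0 (eu i)) (Ae i)) => v.
rewrite !(eigenbasis_braket eE) mulr_sumr; apply: ler_sum => j _.
rewrite (eigenbasis_mul Ae) // mulrCA ler_wpM2r ?lecR //.
by rewrite -normCKC exprn_ge0.
Qed.

(** Only eigenvectors in the kernel of [A] contribute to the expansion of [u] in an eigenbasis. *)
Lemma herm_mul_eq0 A u : A \is hermsymmx ->
  (forall a v, a != 0 -> A *m v = a *: v -> braket u v = 0) -> A *m u = 0.
Proof.
move=> hA hu; have [e [a [eE eu Ae]]] := hermsym_eigenbasis hA.
rewrite {1}(eE u) mulmx_sumr big1 // => i _; rewrite -scalemxAr Ae scalerA.
have [->|a0] := eqVneq ((a i)%:C : C) 0; first by rewrite mulr0 scale0r.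
by rewrite -braket_conj (hu _ _ a0 (Ae i)) rmorph0 mul0r scale0r.
Qed.

(** * The eigenvalue equation of a noisy state *)

Lemma noisy_state_herm (eta : R) u A : A \is hermsymmx ->
  noisy_state eta u A \is hermsymmx.
Proof.
move=> hA; apply: hermsymD; apply: hermsymZ; [exact: projector_herm | exact: hA].
Qed.

Lemma noisy_state_mul (eta : R) u A v : noisy_state eta u A *m v =
  (eta%:C * braket u v) *: u + (1 - eta)%:C *: (A *m v).
Proof. by rewrite mulmxDl -!scalemxAl projectorE scalerA. Qed.

(** [lam] is the largest eigenvalue of the noisy state divided by [eta]. The Rayleigh bound at
    [psi_id] gives [lam >= 1], since the error part contributes a nonnegative amount. *)
Lemma dominant_noisyP (eta : R) psi_id A psi :
  unit_ket psi_id -> 0 < eta <= 1 -> psdmx A ->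
  dominant_eigenvector (noisy_state eta psi_id A) psi ->
  exists2 lam : R, 1 <= lam &
    lam%:C *: psi =
      braket psi_id psi *: psi_id + (eta^-1 - 1)%:C *: (A *m psi).
Proof.
move=> hid /andP[eta0 eta1] [hA A0] [upsi [mu mumax rpsi]].
have eta0C : (eta%:C : C) != 0 by rewrite (inj_eq (@complexI R)) gt_eqF.
exists (eta^-1 * mu).
  have := largest_eigenvalue_le (noisy_state_herm eta psi_id hA) mumax psi_id.
  rewrite noisy_state_mul braketDr !braketZr hid !mulr1 => h.
  rewrite mulrC ler_pdivlMr // mul1r -lecR; apply: le_trans h.
  by rewrite lerDl mulr_ge0 // ler0c subr_ge0.
have VetaC : (eta^-1)%:C * eta%:C = 1 :> C by rewrite -rmorphM mulVf ?gt_eqF.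
rewrite rmorphM -scalerA -rpsi noisy_state_mul scalerDr !scalerA mulrA VetaC.
rewrite mul1r -rmorphM.
by congr (_ + _ *: _); rewrite mulrBr mulr1 mulVf ?gt_eqF.
Qed.

(** Cauchy-Schwarz: [1 - |<u|v>|^2] is the squared norm of the residual [v - <u|v> u]. *)
Lemma overlap_le1 u v : unit_ket u -> unit_ket v ->
  ComplexField.Normc.normc (braket u v) ^+ 2 <= 1.
Proof.
move=> hu hv; rewrite -lecR normc_sqr -subr_ge0.
have := braket_ge0 (v - braket u v *: u).
rewrite braketBl !braketBr !braketZl !braketZr hu hv -(braket_conj u v).
set x := braket u v; set y := Num.conj x.
by have -> : 1 - x * y - (y * x - y * (x * 1)) = 1 - y * x by ring.
Qed.

End Braket.

(* The hypothesis says that [f lam <= 0] for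
   [f t = t ^+ 2 - (2 * w + delta) * t + w * (1 + delta)]. Its discriminant
   gives [4 * w * (1 - w) <= delta ^+ 2]; since [f 1 = (1 - w) * (1 - delta)],
   both roots of [f] lie above [1], which excludes [w <= 1 / 2]. *)
Lemma mismatch_le (R : realType) (delta lam w : R) :
  0 <= delta < 1 -> 1 <= lam -> w <= 1 ->
  lam ^+ 2 - 2 * lam * w + w <= delta * (lam - w) ->
  1 - w <= mismatch_bound delta.
Proof.
move=> /andP[d0 d1] l1 w1 h; rewrite /mismatch_bound.
have sq1 : Num.sqrt (1 - delta ^+ 2) <= 1.
  by rewrite -[leRHS]sqrtr1 ler_wsqrtr // gerBl sqr_ge0.
move: w1; rewrite le_eqVlt => /predU1P[-> | w1]; first by lra.
have w_gt : 2 - delta < 2 * w.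
  have pos : 0 < (1 - w) * (1 - delta) by rewrite mulr_gt0 ?subr_gt0.
  (* [f lam <= 0], expanded around [1]. The left side is positive and [lam - 1 >= 0], so the last
     factor must be positive. *)
  have fE : (lam - 1) ^+ 2 + (1 - w) * (1 - delta)
      <= (lam - 1) * (2 * w + delta - 2).
    rewrite -subr_ge0; suff -> : (lam - 1) * (2 * w + delta - 2) -
      ((lam - 1) ^+ 2 + (1 - w) * (1 - delta)) =
      delta * (lam - w) - (lam ^+ 2 - 2 * lam * w + w) by rewrite subr_ge0.
    by ring.
  rewrite -subr_gt0 (_ : _ - _ = 2 * w + delta - 2); last by ring.
  rewrite ltNge; apply/negP => neg.
  have := mulr_ge0_le0 (_ : 0 <= lam - 1) neg; rewrite subr_ge0 => /(_ l1).
  have := sqr_ge0 (lam - 1); lra.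
have : Num.sqrt (1 - delta ^+ 2) <= Num.sqrt ((2 * w - 1) ^+ 2).
  rewrite ler_wsqrtr // -subr_ge0.
  have := sqr_ge0 (lam - (2 * w + delta) / 2); nra.
rewrite sqrtr_sqr ger0_norm; lra.
Qed.

(** * Dominant eigenvectors of noisy states *)

Section Bound.
Context {R : realType} {d : nat}.
Notation C := R[i].
Implicit Types (u v w chi : 'cV[C]_d) (A : 'M[C]_d).

Lemma error_ratio_ge0 (eta mu : R) : 0 < eta <= 1 -> 0 <= mu ->
  0 <= error_ratio eta mu.
Proof.
by move=> /andP[e0 e1] mu0; rewrite mulr_ge0 // subr_ge0 invf_ge1.
Qed.

Lemma mismatch_bound_valid (psi_id psi : 'cV[C]_d) A (eta mu : R) :
  unit_ket psi_id -> 0 < eta <= 1 -> error_ratio eta mu < 1 ->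
  density_matrix A -> largest_eigenvalue A mu ->
  dominant_eigenvector (noisy_state eta psi_id A) psi ->
  coherent_mismatch psi_id psi <= mismatch_bound (error_ratio eta mu).
Proof.
move=> hid heta hd [hA _] hmu hpsi.
have upsi := hpsi.1.
have [lam lam1 lamE] := dominant_noisyP hid heta hA hpsi.
have mu0 := psd_largest_eigenvalue_ge0 hA hmu.
have k0 : 0 <= eta^-1 - 1.
  by have := error_ratio_ge0 heta ler01; rewrite /error_ratio mulr1.
apply: (mismatch_le (lam := lam)) => //.
- by rewrite error_ratio_ge0.
- exact: overlap_le1.
set k := eta^-1 - 1 in k0 lamE.
have dE : error_ratio eta mu = k * mu by [].
clearbody k.
set x := braket psi_id psi in lamE *.
set w := ComplexField.Normc.normc _ ^+ 2.
have wE : w%:C = Num.conj x * x by exact: normc_sqr.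
clearbody w.
(* With [B = k A], this and the next two identities express [B psi], [<psi|B psi>] and the squared
   norm of [B psi] through the eigenvalue equation. *)
have BE : k%:C *: (A *m psi) = lam%:C *: psi - x *: psi_id.
  by rewrite lamE addrC addKr.
have kq : k%:C * braket psi (A *m psi) = lam%:C - w%:C.
  rewrite -braketZr BE braketBr !braketZr upsi mulr1 wE mulrC.
  by rewrite -(braket_conj psi_id) mulrC.
have kk : k%:C * k%:C * braket (A *m psi) (A *m psi) =
    (lam ^+ 2 - 2 * lam * w + w)%:C.
  transitivity (braket (k%:C *: (A *m psi)) (k%:C *: (A *m psi))).
    by rewrite braketZl braketZr conjC_real mulrA.
  rewrite BE braketBl !braketBr !braketZl !braketZr upsi hid conjC_real.
  rewrite -/x -(braket_conj psi_id psi) -/x !(rmorphD, rmorphN, rmorphM, rmorphXn).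
  rewrite rmorph1 /= wE; ring.
rewrite dE -lecR -kk rmorphM rmorphB /= -kq.
(* Multiplying [A^2 <= mu A] by [k^2] turns it into [B^2 <= delta B]. *)
have := psd_largest_eigenvalue_sqr psi hA hmu.
move=> /(ler_wpM2l (_ : 0 <= (k * k)%:C)); rewrite ler0c => /(_ (mulr_ge0 k0 k0)).
rewrite !rmorphM /= => h; apply: (le_trans h); rewrite le_eqVlt; apply/orP; left.
by apply/eqP; ring.
Qed.

(** Saturation is derived from these relations, in which [phi2] no longer occurs. The condition on
    the other eigenvectors enters through [A - mu |chi><chi|] annihilating [psi_id]. *)
Lemma worst_case_form_mul (psi_id : 'cV[C]_d) (mu alpha : R) A :
  unit_ket psi_id -> worst_case_form psi_id mu alpha A ->
  exists chi : 'cV[C]_d,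
    [/\ unit_ket chi, braket psi_id chi = (Num.sqrt alpha)%:C,
        A *m chi = mu%:C *: chi &
        A *m psi_id = (mu * Num.sqrt alpha)%:C *: chi].
Proof.
move=> hid [[[hA _] _] _ /andP[al0 al1] [phi [hphi orth]]].
set chi := _ + _ => -[Achi hker].
have orth' : braket psi_id phi = 0 by rewrite -braket_conj orth rmorph0.
have id_chi : braket psi_id chi = (Num.sqrt alpha)%:C.
  by rewrite /chi braketDr !braketZr hid orth' mulr0 addr0 mulr1.
have uchi : unit_ket chi.
  rewrite /unit_ket /chi braketDl !braketDr !braketZl !braketZr.
  rewrite hid hphi orth orth' !conjC_real !mulr0 !mulr1 addr0 add0r.
  rewrite -!rmorphM -rmorphD /= -!expr2 !sqr_sqrtr ?subr_ge0 ?(ltW al0) //.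
  by rewrite addrC subrK.
exists chi; split=> //.
(* Deflating [chi] leaves an operator all of whose eigenvectors with nonzero
   eigenvalue are orthogonal to [psi_id]. *)
pose B := A + (- mu)%:C *: projector chi.
have hB : B \is hermsymmx.
  by apply: hermsymD; [exact: hA | apply: hermsymZ]; exact: projector_herm.
have BE v : B *m v = A *m v - (mu%:C * braket chi v) *: chi.
  rewrite mulmxDl -scalemxAl projectorE scalerA.
  by rewrite rmorphN mulNr scaleNr.
have Bchi : B *m chi = 0 by rewrite BE Achi uchi mulr1 subrr.
have : B *m psi_id = 0.
  apply: herm_mul_eq0 => // a v a0 Bv.
  (* [a <chi|v> = <chi|B v> = <B chi|v> = 0]; hence [v] is also an eigenvector of [A] for [a]. *)
  have chi_v : braket chi v = 0.
    apply/eqP; rewrite -(mulrI_eq0 (braket chi v) (mulfI a0)) -braketZr -Bv.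
    by rewrite -braket_herm // Bchi -braket_conj braket0r rmorph0.
  apply: (hker a) => //; rewrite -Bv BE chi_v.
  by rewrite mulr0 scale0r subr0.
move/eqP; rewrite BE subr_eq0 => /eqP ->.
by rewrite -(braket_conj psi_id) id_chi conjC_real rmorphM.
Qed.

(** [w] and [u] stand for the squared overlaps of [psi] with [psi_id] and [chi]. Cancelling [w]
    leaves a quadratic equation for [lam] with discriminant [1 - delta^2]; its root above [1]
    determines [w]. *)
Lemma mismatch_eq (delta lam w u : R) :
  0 <= delta < 1 -> 1 <= lam ->
  (lam - delta) ^+ 2 * u = worst_case_overlap delta * w ->
  (lam - 1) * (lam - delta) * w = delta * worst_case_overlap delta * w ->
  lam = w + delta * u ->
  1 - w = mismatch_bound delta.
Proof.
rewrite /worst_case_overlap /mismatch_bound => /andP[d0 d1] l1 hu hw hl.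
have ld : 0 < lam - delta by lra.
have w0 : w != 0.
  apply/eqP => w0; move/eqP: hu; rewrite w0 mulr0 mulf_eq0 sqrf_eq0 gt_eqF //=.
  by move=> /eqP u0; move: hl; rewrite w0 u0; lra.
have {}hw : (lam - 1) * (lam - delta) = delta * ((1 - delta) / 2).
  exact: (mulIf w0).
set s := Num.sqrt _.
(* [lam >= 1] makes the right side positive, which selects the larger root. *)
have sE : s = 2 * lam - 1 - delta.
  rewrite /s (_ : 1 - delta ^+ 2 = (2 * lam - 1 - delta) ^+ 2).
    by rewrite sqrtr_sqr ger0_norm //; lra.
  by apply/eqP; rewrite -subr_eq0; apply/eqP; lra.
have s0 : 0 < s by rewrite sE; lra.
(* Multiply [lam = w + delta u] by [(lam - delta)^2], eliminate [u] by [hu], then trade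
   [delta alpha w] for [(lam - 1)(lam - delta) w]; the factor [2 lam - 1 - delta = s] appears. *)
have key : (lam - delta) * lam = w * s.
  apply: (mulfI (lt0r_neq0 ld)); rewrite sE.
  have h1 : (lam - delta) ^+ 2 * lam = (lam - delta) ^+ 2 * (w + delta * u).
    by rewrite -hl.
  have h2 : delta * ((lam - delta) ^+ 2 * u) = delta * ((1 - delta) / 2 * w).
    by rewrite hu.
  have h3 : (lam - 1) * (lam - delta) * w = delta * ((1 - delta) / 2) * w.
    by rewrite hw.
  lra.
have lamE : lam = (1 + delta + s) / 2 by rewrite sE; lra.
have s2 : s ^+ 2 = 1 - delta ^+ 2 by rewrite sqr_sqrtr //; nra.
have : w = (1 + s) / 2.
  apply: (mulIf (lt0r_neq0 s0)); rewrite -key lamE.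
  apply/eqP; rewrite -subr_eq0; apply/eqP.
  transitivity ((1 - delta ^+ 2 - s ^+ 2) / 4); first by field.
  by rewrite s2 subrr mul0r.
by move=> ->; field.
Qed.

Lemma worst_case_saturates (psi_id psi : 'cV[C]_d) A (eta mu : R) :
  unit_ket psi_id -> 0 < eta <= 1 -> error_ratio eta mu < 1 ->
  worst_case_form psi_id mu (worst_case_overlap (error_ratio eta mu)) A ->
  dominant_eigenvector (noisy_state eta psi_id A) psi ->
  coherent_mismatch psi_id psi = mismatch_bound (error_ratio eta mu).
Proof.
move=> hid heta hd hwc hpsi; have [[hA _] hmu /andP[al0 _] _] := hwc.
have upsi := hpsi.1.
have [lam lam1 lamE] := dominant_noisyP hid heta hA hpsi.
have mu0 := psd_largest_eigenvalue_ge0 hA hmu.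
have d0 := error_ratio_ge0 heta mu0.
have k0 : 0 <= eta^-1 - 1.
  by have := error_ratio_ge0 heta ler01; rewrite /error_ratio mulr1.
have [chi [uchi id_chi Achi Aid]] := worst_case_form_mul hid hwc.
set delta := error_ratio eta mu in hd d0 al0 id_chi Aid *.
have deltaE : delta = (eta^-1 - 1) * mu by [].
set k := eta^-1 - 1 in k0 lamE deltaE; clearbody k delta.
set alpha := worst_case_overlap delta in al0 id_chi Aid.
set r := Num.sqrt alpha in id_chi Aid.
have rr : r * r = alpha by rewrite -expr2 sqr_sqrtr // ltW.
clearbody r.
set x := braket psi_id psi in lamE.
set y := braket chi psi.
(* Pairing the eigenvalue equation with [psi_id] and with [chi] gives a closed linear system for the
   two overlaps. *)
have hx : lam%:C * x = x + (delta * r)%:C * y.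
  rewrite -braketZr lamE braketDr !braketZr hid mulr1 -braket_herm; last exact: hA.1.
  by rewrite Aid braketZl conjC_real -/y deltaE !rmorphM /=; ring.
have hy : lam%:C * y = r%:C * x + delta%:C * y.
  rewrite -braketZr lamE braketDr !braketZr -braket_herm; last exact: hA.1.
  rewrite Achi braketZl conjC_real -/y deltaE -(braket_conj psi_id) id_chi.
  by rewrite conjC_real !rmorphM /=; ring.
(* The difference [v] of the two sides satisfies [k A v = lam v]. Since [k A <= delta < 1 <= lam],
   it must vanish; so [psi] lies in the span of [psi_id] and [chi]. *)
have psiE : lam%:C *: psi = x *: psi_id + (delta%:C * y) *: chi.
  apply/eqP; rewrite -subr_eq0; set v := _ - _; apply: contraT => v0.
  have hv : k%:C *: (A *m v) = lam%:C *: v.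
    rewrite /v mulmxBr mulmxDr -!scalemxAr Achi Aid.
    move: (A *m psi) lamE => q lamE; apply/colP => i.
    have := congr1 (fun z : 'cV_d => z i 0) lamE; rewrite !mxE => qE.
    transitivity (lam%:C * (k%:C * q i 0)
        - delta%:C * (r%:C * x + delta%:C * y) * chi i 0).
      by rewrite deltaE !rmorphM /=; ring.
    by rewrite -hy (_ : k%:C * _ = lam%:C * psi i 0 - x * psi_id i 0);
      [ring | rewrite qE; ring].
  have := largest_eigenvalue_le hA.1 hmu v.
  move=> /(ler_wpM2l (_ : 0 <= k%:C)); rewrite ler0c => /(_ k0).
  rewrite -(braketZr _ _ (A *m v)) hv braketZr mulrA -rmorphM -deltaE.
  rewrite ler_pM2r ?braket_gt0 //.
  by rewrite lecR => /(le_trans lam1); rewrite leNgt hd.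
set w := ComplexField.Normc.normc x ^+ 2.
pose u := ComplexField.Normc.normc y ^+ 2.
have wE : w%:C = Num.conj x * x by exact: normc_sqr.
have uE : u%:C = Num.conj y * y by exact: normc_sqr.
rewrite /coherent_mismatch -/x -/w; clearbody w u.
have hy' : (lam - delta)%:C * y = r%:C * x.
  by rewrite rmorphB /= mulrBl hy addrK.
apply: (@mismatch_eq delta lam w u); rewrite ?d0 //; apply: (@complexI R).
- rewrite -/alpha -rr !rmorphM /= uE wE.
  transitivity (Num.conj ((lam - delta)%:C * y) * ((lam - delta)%:C * y)).
    by rewrite rmorphM /= conjC_real; ring.
  by rewrite hy' rmorphM /= conjC_real; ring.
- rewrite -/alpha -rr !rmorphM /= wE.
  transitivity (Num.conj x * (lam - delta)%:C * (lam%:C * x - x)).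
    by rewrite !rmorphB rmorph1 /=; ring.
  rewrite (_ : _ - x = (delta * r)%:C * y); last by rewrite hx addrC addKr.
  transitivity (Num.conj x * (delta * r)%:C * ((lam - delta)%:C * y)).
    by ring.
  by rewrite hy' !rmorphM /=; ring.
rewrite rmorphD rmorphM /= wE uE.
transitivity (braket psi (lam%:C *: psi)); first by rewrite braketZr upsi mulr1.
rewrite psiE braketDr !braketZr -(braket_conj psi_id) -(braket_conj chi) -/x -/y.
by congr (_ + _); rewrite ?(mulrC x) // -mulrA (mulrC y).
Qed.

(** * Worst-case error states *)

Section WorstCase.
Variables (psi_id phi : 'cV[C]_d) (mu alpha : R).
Hypotheses (hid : unit_ket psi_id) (hphi : unit_ket phi)
  (orth : braket phi psi_id = 0).

Definition worst_case_ket : 'cV[C]_d :=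
  (Num.sqrt alpha)%:C *: psi_id + (Num.sqrt (1 - alpha))%:C *: phi.

(* The remaining weight [1 - mu] is spread uniformly over the complement of
   span(psi_id, phi); for [d = 2], [mu = 1] and the junk coefficient
   [0 / 0 = 0] multiplies the zero projector. *)
Definition worst_case_state : 'M[C]_d :=
  mu%:C *: projector worst_case_ket +
  ((1 - mu) / (d%:R - 2))%:C *: (1%:M - projector psi_id - projector phi).

Let kap : R := (1 - mu) / (d%:R - 2).

Let orth' : braket psi_id phi = 0.
Proof. by rewrite -braket_conj orth rmorph0. Qed.

Let ketE v : braket worst_case_ket v =
  (Num.sqrt alpha)%:C * braket psi_id v +
  (Num.sqrt (1 - alpha))%:C * braket phi v.
Proof. by rewrite braketDl !braketZl !conjC_real. Qed.

Lemma worst_case_ketE : braket psi_id worst_case_ket = (Num.sqrt alpha)%:C.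
Proof. by rewrite braketDr !braketZr hid orth' mulr0 addr0 mulr1. Qed.

Let ketE' : braket phi worst_case_ket = (Num.sqrt (1 - alpha))%:C.
Proof. by rewrite braketDr !braketZr hphi orth mulr0 add0r mulr1. Qed.

Lemma worst_case_state_mul v : worst_case_state *m v =
  (mu%:C * braket worst_case_ket v) *: worst_case_ket +
  kap%:C *: (v - braket psi_id v *: psi_id - braket phi v *: phi).
Proof.
rewrite mulmxDl -!scalemxAl !mulmxBl mul1mx !projectorE scalerA.
by [].
Qed.

Hypothesis (al01 : 0 < alpha <= 1).

Let rr : (Num.sqrt alpha)%:C * (Num.sqrt alpha)%:C = alpha%:C :> C.
Proof. by rewrite -rmorphM -expr2 sqr_sqrtr //; case/andP: al01 => /ltW. Qed.

Let rr' : (Num.sqrt (1 - alpha))%:C * (Num.sqrt (1 - alpha))%:C = 1 - alpha%:C :> C.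
Proof.
rewrite -rmorphM -expr2 sqr_sqrtr ?rmorphB //.
by rewrite subr_ge0; case/andP: al01.
Qed.

Lemma worst_case_ket_unit : unit_ket worst_case_ket.
Proof. by rewrite /unit_ket ketE worst_case_ketE ketE' rr rr' addrC subrK. Qed.

Lemma worst_case_state_ket :
  worst_case_state *m worst_case_ket = mu%:C *: worst_case_ket.
Proof.
rewrite worst_case_state_mul worst_case_ket_unit mulr1 worst_case_ketE ketE'.
by rewrite -addrA -opprD subrr scaler0 addr0.
Qed.

Lemma worst_case_state_id : worst_case_state *m psi_id =
  (mu * Num.sqrt alpha)%:C *: worst_case_ket.
Proof.
rewrite worst_case_state_mul -braket_conj worst_case_ketE conjC_real -rmorphM.
by rewrite hid orth scale1r scale0r subrr subr0 scaler0 addr0.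
Qed.

Lemma worst_case_state_herm : worst_case_state \is hermsymmx.
Proof.
have hN (u : 'cV[C]_d) : - projector u \is hermsymmx.
  by rewrite -scaleN1r -(rmorphN1 (real_complex R)); apply/hermsymZ/projector_herm.
apply: hermsymD; apply: hermsymZ; first exact: projector_herm.
by do 2!apply: hermsymD => //; exact: hermitian1mx_subproof.
Qed.

(** The eigenvalue [mu] on the ket and the [d - 2] copies of [kap] sum to one, so [kap <= mu] forces
    [mu >= 1 / (d - 1)]. *)
Hypotheses (d_gt1 : (1 < d)%N) (mu_ge : (d.-1)%:R^-1 <= mu) (mu_le1 : mu <= 1).

Let mu_gt0 : 0 < mu.
Proof.
by apply: lt_le_trans mu_ge; rewrite invr_gt0 ltr0n; case: d d_gt1 => [|[]].
Qed.

Let d2 : d%:R - 2 = (d - 2)%N%:R :> R.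
Proof. by rewrite natrB. Qed.

Let mu_d : 1 <= mu * (d%:R - 2) + mu.
Proof.
rewrite -[X in _ + X]mulr1 -mulrDr mulrC.
have -> : d%:R - 2 + 1 = (d.-1)%:R :> R.
  by case: d d_gt1 => [|n] //= _; rewrite -natr1; ring.
rewrite -ler_pdivrMl ?mulr1 //.
by rewrite ltr0n; case: d d_gt1 => [|[]].
Qed.

Let kap_ge0 : 0 <= kap.
Proof. by rewrite /kap d2 divr_ge0 ?subr_ge0. Qed.

Let kap_le : kap <= mu.
Proof.
rewrite /kap d2; case: (posnP (d - 2)) => [-> | h].
  by rewrite invr0 mulr0 ltW.
by rewrite ler_pdivrMr ?ltr0n // -d2 lerBlDr.
Qed.

Let kap_d : mu + kap * (d%:R - 2) = 1.
Proof.
(* For [d = 2] there is no complement to carry weight, and the two bounds on [mu] force [mu = 1]. *)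
rewrite /kap; have [h|h] := eqVneq (d%:R - 2 : R) 0.
  by rewrite h mulr0 addr0; apply/le_anti; move: mu_d; rewrite h mulr0 add0r mu_le1.
by rewrite mulfVK // addrC subrK.
Qed.

Let proj_sqr u v : braket u v * braket v u = Num.conj (braket u v) * braket u v.
Proof. by rewrite braket_conj mulrC. Qed.

(** The vector paired with [v] is its orthogonal projection onto the complement of span(psi_id,
    phi). *)
Let rest_sqr v : braket v (v - braket psi_id v *: psi_id - braket phi v *: phi) =
  braket (v - braket psi_id v *: psi_id - braket phi v *: phi)
         (v - braket psi_id v *: psi_id - braket phi v *: phi).
Proof.
rewrite [RHS]braketBl braketBl !braketZl.
rewrite (_ : braket psi_id (v - _ - _) = 0); last first.
  by rewrite !braketBr !braketZr hid orth' mulr0 subr0 mulr1 subrr.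
rewrite (_ : braket phi (v - _ - _) = 0); last first.
  by rewrite !braketBr !braketZr hphi orth mulr0 subr0 mulr1 subrr.
by rewrite !mulr0 !subr0.
Qed.

Let state_form v : braket v (worst_case_state *m v) =
  mu%:C * (Num.conj (braket worst_case_ket v) * braket worst_case_ket v) +
  kap%:C * braket v (v - braket psi_id v *: psi_id - braket phi v *: phi).
Proof.
by rewrite worst_case_state_mul [LHS]braketDr !(braketZr v) -mulrA proj_sqr.
Qed.

Lemma worst_case_state_psd : psdmx worst_case_state.
Proof.
split; first exact: worst_case_state_herm.
move=> v; rewrite state_form rest_sqr addr_ge0 // mulr_ge0 ?ler0c ?braket_ge0 //.
  exact: ltW.
by rewrite -normCKC exprn_ge0.
Qed.

Lemma worst_case_state_largest : largest_eigenvalue worst_case_state mu.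
Proof.
apply: (largest_eigenvalueP worst_case_state_herm
  (unit_ket_neq0 worst_case_ket_unit) worst_case_state_ket) => v.
set z := v - braket psi_id v *: psi_id - braket phi v *: phi.
have zE : braket v z = braket v v - Num.conj (braket psi_id v) * braket psi_id v
    - Num.conj (braket phi v) * braket phi v.
  rewrite /z !braketBr !braketZr -(braket_conj psi_id) -(braket_conj phi).
  by rewrite !(mulrC _^*%R).
have z0 : 0 <= braket v z by rewrite rest_sqr braket_ge0.
rewrite state_form -/z.
(* Raising [kap] to [mu] reduces the claim to [|<chi|v>|^2 + <v|z> <= <v|v>]. *)
have h : kap%:C * braket v z <= mu%:C * braket v z by rewrite ler_wpM2r // lecR.
apply: (le_trans (lerD (lexx _) h)); rewrite -mulrDr.
rewrite ler_wpM2l ?ler0c ?(ltW mu_gt0) //.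
rewrite zE ketE rmorphD !rmorphM /= !conjC_real -subr_ge0.
set a := braket psi_id v; set b := braket phi v.
(* The component of [v] along the unit vector of span(psi_id, phi) orthogonal to the ket; the
   remaining gap is exactly [|q|^2]. *)
pose q := (Num.sqrt (1 - alpha))%:C * a - (Num.sqrt alpha)%:C * b.
have := exprn_ge0 2 (normr_ge0 q); rewrite normCKC /q rmorphB !rmorphM /= !conjC_real.
have [] := (rr, rr').
set r := (Num.sqrt alpha)%:C; set s := (Num.sqrt (1 - alpha))%:C => e1 e2.
set a' := Num.conj a; set b' := Num.conj b; clearbody r s a' b'.
suff -> : (s * a' - r * b') * (s * a - r * b) =
  a' * a + b' * b - (r * a' + s * b') * (r * a + s * b).
  by congr (0 <= _); ring.
have e : r * r + s * s = 1 by rewrite e1 e2 addrC subrK.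
transitivity ((r * r + s * s) * (a' * a + b' * b) -
    (r * a' + s * b') * (r * a + s * b)).
  by ring.
by rewrite e mul1r.
Qed.

Lemma worst_case_state_trace : \tr worst_case_state = 1.
Proof.
have tr_proj u : unit_ket u -> \tr (projector u) = 1.
  by move=> hu; rewrite mxtrace_mulC trace_mx11.
rewrite mxtraceD !mxtraceZ !linearB /= mxtrace1.
rewrite (tr_proj _ worst_case_ket_unit) (tr_proj _ hid) (tr_proj _ hphi).
have -> : (d%:R - 1 - 1 : C) = (d%:R - 2)%:C.
  by rewrite rmorphB /= !rmorph_nat -addrA -opprD.
by rewrite mulr1 -rmorphM -rmorphD /= -/kap kap_d.
Qed.

Lemma worst_case_stateP : worst_case_form psi_id mu alpha worst_case_state.
Proof.
split=> //; [by split; [exact: worst_case_state_psd | exact: worst_case_state_trace] |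
  exact: worst_case_state_largest |].
exists phi; split=> //; split; first exact: worst_case_state_ket.
(* On [v] orthogonal to the ket the state acts as [kap] times the projection onto the complement,
   whose range is orthogonal to [psi_id]. *)
move=> a v a0 Av chi_v; apply/eqP; rewrite -(mulrI_eq0 (braket psi_id v) (mulfI a0)).
rewrite -braketZr -Av worst_case_state_mul chi_v mulr0 scale0r add0r.
by rewrite braketZr !braketBr !braketZr hid orth' mulr0 mulr1 subrr subr0 mulr0.
Qed.

End WorstCase.

(** * An infinite family from the phase of [phi] *)

Local Open Scope sesquilinear_scope.

(** The columns of the cokernel of the row [u^t*] are orthogonal to [u], and one is nonzero because
    the row has rank at most [1 < d]; it is then normalized. *)
Lemma unit_orthogonal_exists (u : 'cV[C]_d) : (1 < d)%N ->
  exists2 v : 'cV[C]_d, unit_ket v & braket v u = 0.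
Proof.
move=> d1; pose K := cokermx (u ^t*).
have K0 : K != 0.
  rewrite -mxrank_eq0 mxrank_coker -lt0n subn_gt0.
  exact: leq_ltn_trans (rank_leq_row _) d1.
have [j v0] : exists j, col j K != 0.
  apply/existsP; apply: contraNT K0; rewrite negb_exists => /forallP K0.
  apply/eqP/matrixP => i j; have /eqP/colP/(_ i) := negbNE (K0 j).
  by rewrite !mxE.
pose n := Num.sqrt (complex.Re (braket (col j K) (col j K))).
have g0 := braket_gt0 v0.
have nE : (complex.Re (braket (col j K) (col j K)))%:C = braket (col j K) (col j K).
  by rewrite RRe_real // ger0_real // ltW.
have n0 : 0 < complex.Re (braket (col j K) (col j K)) by rewrite -ltcR nE.
exists (n^-1%:C *: col j K).
  rewrite /unit_ket braketZl braketZr conjC_real -nE -!rmorphM /=.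
  rewrite mulrA -expr2 exprVn sqr_sqrtr ?ltW // mulVf ?gt_eqF //.
rewrite braketZl -braket_conj /braket colE mulmxA mulmx_coker mul0mx mxE.
by rewrite rmorph0 mulr0.
Qed.

(** Points of the unit circle told apart by their real parts [1 / (n + 1)]. *)
Definition unit_phase (n : nat) : C :=
  n.+1%:R^-1 +i* Num.sqrt (1 - n.+1%:R^-1 ^+ 2).

Lemma unit_phase_norm n : Num.conj (unit_phase n) * unit_phase n = 1.
Proof.
rewrite -normc_sqr /= sqr_sqrtr ?addr_ge0 ?sqr_ge0 // sqr_sqrtr.
  by rewrite addrC subrK.
by rewrite subr_ge0 expr_le1 ?invr_ge0 // invf_le1 ?ltr0n // ler1n.
Qed.

Lemma unit_phase_inj : injective unit_phase.
Proof. by move=> m n [/invr_inj/eqP]; rewrite eqr_nat => /eqP []. Qed.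

Lemma infinite_worst_case (psi_id : 'cV[C]_d) (mu alpha : R) :
  unit_ket psi_id -> (1 < d)%N -> (d.-1)%:R^-1 <= mu <= 1 -> 0 < alpha < 1 ->
  infinite_set [set A | worst_case_form psi_id mu alpha A].
Proof.
move=> hid d1 /andP[mu1 mu2] /andP[al0 al1].
have [phi hphi orth] := unit_orthogonal_exists psi_id d1.
pose f n := worst_case_state psi_id (unit_phase n *: phi) mu alpha.
have orthn n : braket (unit_phase n *: phi) psi_id = 0.
  by rewrite braketZl orth mulr0.
have hphin n : unit_ket (unit_phase n *: phi).
  by rewrite /unit_ket braketZl braketZr hphi mulr1 unit_phase_norm.
have al01 : 0 < alpha <= 1 by rewrite al0 ltW.
have finj : injective f.
  (* The matrix element [<phi|f n|psi_id>] equals [c] times the phase, so it recovers [n]; [c] is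
     nonzero because [mu > 0] and [0 < alpha < 1]. *)
  pose c : C := (mu * Num.sqrt alpha * Num.sqrt (1 - alpha))%:C.
  have c0 : c != 0.
    rewrite (inj_eq (@complexI R)) !mulf_neq0 // gt_eqF ?sqrtr_gt0 ?subr_gt0 //.
    apply: lt_le_trans mu1; rewrite invr_gt0 ltr0n.
    by rewrite -subn1 subn_gt0.
  have fE n : braket phi (f n *m psi_id) = c * unit_phase n.
    rewrite /f (worst_case_state_id mu alpha hid (orthn n)).
    by rewrite braketZr braketDr !braketZr orth hphi mulr0 add0r mulr1 mulrA -rmorphM.
  move=> m n fmn; apply/unit_phase_inj/(mulfI c0).
  by rewrite -(fE m) -(fE n) fmn.
move=> fin; apply: infinite_nat.
have -> : [set: nat] = f @^-1` [set A | worst_case_form psi_id mu alpha A].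
  by apply/seteqP; split=> // n _; exact: worst_case_stateP.
by apply: finite_preimage fin => m n _ _; exact: finj.
Qed.

End Bound.

Lemma mismatch_bound_expansion (R : realType) (x : R) :
  mismatch_bound x = x ^+ 2 / 4 +O_(x \near (0 : R)) (x ^+ 4 / 16).
Proof.
move: x; apply/funeqP; apply/eqaddOP/bigO_exP.
(* The error will be at most [x^4 / 4], which is [4] times [x^4 / 16]. *)
exists 4 => //; near=> x.
have x1 : x ^+ 2 <= 1.
  have x1 : `|x| <= 1.
    rewrite ltW //; near: x; exact: (@nbhs0_lt R R 1).
  by rewrite -real_normK ?num_real // expr_le1.
set s := Num.sqrt (1 - x ^+ 2).
have s0 : 0 <= s by exact: sqrtr_ge0.
have s2 : s ^+ 2 = 1 - x ^+ 2 by rewrite sqr_sqrtr ?subr_ge0.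
change (`|mismatch_bound x - x ^+ 2 / 4| <= 4 * `|x ^+ 4 / 16|).
(* The remainder is exact, by [x^2 = 1 - s^2]; the same identity gives [1 - s <= x^2]. *)
have -> : mismatch_bound x - x ^+ 2 / 4 = (1 - s) ^+ 2 / 4.
  by rewrite /mismatch_bound -/s; lra.
rewrite !ger0_norm ?divr_ge0 ?exprn_even_ge0 //.
have : (1 - s) ^+ 2 <= (x ^+ 2) ^+ 2.
  have -> : x ^+ 2 = (1 - s) * (1 + s) by rewrite -subr_sqr expr1n s2; ring.
  by rewrite exprMn ler_peMr ?sqr_ge0 // exprn_ege1 // lerDl.
rewrite -exprM; lra.
Unshelve. all: by end_near. Qed.

Theorem theorem1 (R : realType) (d : nat) (psi_id : 'cV[R[i]]_d) (eta mu1 : R)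
    (hpsi_id : unit_ket psi_id) (heta : 0 < eta <= 1)
    (hdelta : error_ratio eta mu1 < 1) :
  let delta := error_ratio eta mu1 in
  let alpha_wc := worst_case_overlap delta in
  [/\ (* the bound *)
      forall (rho_err : 'M[R[i]]_d) (psi : 'cV[R[i]]_d),
        density_matrix rho_err -> largest_eigenvalue rho_err mu1 ->
        dominant_eigenvector (noisy_state eta psi_id rho_err) psi ->
        coherent_mismatch psi_id psi <= mismatch_bound delta,
      (* its expansion *)
      forall x : R, mismatch_bound x =
        x ^+ 2 / 4 +O_(x \near (0 : R)) (x ^+ 4 / 16),
      (* infinitely many error states of the worst-case form saturate it, for
         every mu1 that an error state of this form can have *)
      (1 < d)%N -> (d.-1)%:R^-1 <= mu1 <= 1 ->
        infinite_set [set rho_err : 'M[R[i]]_d |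
          worst_case_form psi_id mu1 alpha_wc rho_err /\
          exists2 psi : 'cV[R[i]]_d,
            dominant_eigenvector (noisy_state eta psi_id rho_err) psi &
            coherent_mismatch psi_id psi = mismatch_bound delta] &
      (* the mismatch is maximal at alpha_wc, where the bound is attained *)
      forall (rho_err : 'M[R[i]]_d) (psi : 'cV[R[i]]_d),
        worst_case_form psi_id mu1 alpha_wc rho_err ->
        dominant_eigenvector (noisy_state eta psi_id rho_err) psi ->
        coherent_mismatch psi_id psi = mismatch_bound delta /\
        forall (alpha : R) (rho_err' : 'M[R[i]]_d) (psi' : 'cV[R[i]]_d),
          worst_case_form psi_id mu1 alpha rho_err' ->
          dominant_eigenvector (noisy_state eta psi_id rho_err') psi' ->
          coherent_mismatch psi_id psi' <= coherent_mismatch psi_id psi].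
Proof.
move=> delta alpha_wc; split.
- by move=> rho_err psi; exact: mismatch_bound_valid.
- exact: mismatch_bound_expansion.
- move=> d1 hmu.
  have mu0 : 0 <= mu1 by case/andP: hmu => + _; apply: le_trans; rewrite invr_ge0.
  have al01 : 0 < alpha_wc < 1.
    have := error_ratio_ge0 heta mu0; rewrite -/delta /alpha_wc /worst_case_overlap.
    by move: hdelta; rewrite -/delta => ? ?; apply/andP; split; lra.
  (* Every state of the worst-case form at [alpha_wc] saturates the bound, so the saturating set
     contains an infinite one. *)
  apply: contra_not (infinite_worst_case hpsi_id d1 hmu al01).
  apply: sub_finite_set => rho_err hrho; split => //.
  have [[[hA _] _] _ _ _] := hrho.
  have [psi hpsi] :=
    dominant_eigenvector_exists (ltnW d1) (noisy_state_herm eta psi_id hA).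
  by exists psi => //; exact: worst_case_saturates hpsi.
move=> rho_err psi hrho hpsi.
have -> : coherent_mismatch psi_id psi = mismatch_bound delta.
  exact: worst_case_saturates hpsi.
(* The bound depends only on [eta] and [mu1], so it also limits the mismatch at every other
   [alpha]. *)
split=> // alpha rho_err' psi' [hrho' hmu' _ _]; exact: mismatch_bound_valid.
Qed.
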